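(* Let $\mathcal{C}$ be a small strict monoidal Ab-category, let $S_0$ be an infinite set, and let $\mathcal{C}^{S_0}$ be the associated monoidal category (defined in the context). Then $\mathcal{C}^{S_0}$ has a full subcategory which is tensor equivalent to $\mathcal{C}$.
   Context: An Ab-category is a category whose hom-sets are additive abelian groups with bilinear composition; in a monoidal Ab-category the tensor product of morphisms is also assumed bilinear. The category $\mathcal{C}^{S_0}$. Objects are functions $f:S_f\to \mathrm{Obj}(\mathcal{C})$ with $S_f\subset S_0$ any subset. A morphism $F:f\to g$ is a function on $S_f\times S_g$ assigning to $(x,y)$ a morphism $F(x,y):f(x)\to g(y)$ of $\mathcal{C}$ such that, if $S_g$ is infinite, for each $x\in S_f$ there is a finite set $S^F_x\subset S_g$ with $F(x,y)=0$ for $y\in S_g\setminus S_x^F$. Composition is $(G\circ F)(x,y)=\sum_{z\in S_g}G(z,y)\circ F(x,z)$; identities are $\mathrm{Id}_f(x,y)=\delta_{x,y}\mathrm{id}_{f(x)}$ (here and below, $\delta$ times a morphism means that morphism when the indices agree and the zero morphism otherwise). Monoidal structure. Fix a bijection $\gamma:S_0\times S_0\to S_0$ and a point $\ast\in S_0$. For objects $f,g$, $f\otimes g:\gamma(S_f\times S_g)\to\mathrm{Obj}(\mathcal{C})$ is $(f\otimes g)(\gamma(x,y))=f(x)\otimes g(y)$. The unit object is $\mathrm{I}:\{\ast\}\to \mathrm{Obj}(\mathcal{C})$, $\ast\mapsto \mathrm{I}$. For morphisms $F:f\to f'$, $G:g\to g'$, $(F\otimes G)(\gamma(x,y),\gamma(x',y'))=F(x,x')\otimes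 G(y,y')$. The associativity constraint $A_{f,g,h}:(f\otimes g)\otimes h\to f\otimes(g\otimes h)$ is $A_{f,g,h}(\gamma(\gamma(x,y),z),\gamma(x',\gamma(y',z')))=\delta_{x,x'}\delta_{y,y'}\delta_{z,z'}\mathrm{id}_{f(x)\otimes g(y)\otimes h(z)}$; the units $R_f:f\otimes\mathrm{I}\to f$, $L_f:\mathrm{I}\otimes f\to f$ are $R_f(\gamma(x,\ast),x')=\delta_{x,x'}\mathrm{id}_{f(x)}$ and $L_f(\gamma(\ast,x),x')=\delta_{x,x'}\mathrm{id}_{f(x)}$. A tensor functor is a triple $(F,\varphi_0,\varphi_2)$ with $F$ a functor, $\varphi_0:\mathrm{I}\to F(\mathrm{I})$ an isomorphism, and $\varphi_2(U,V):F(U)\otimes F(V)\to F(U\otimes V)$ a family of natural isomorphisms, compatible with the associativity constraints and the left and right units. A full subcategory $\mathcal{D}$ of $\mathcal{C}^{S_0}$ being tensor equivalent to $\mathcal{C}$ means: $\mathcal{D}$ contains the unit object and is closed under $\otimes$ (so it inherits a monoidal structure), and there is a tensor functor $\mathcal{C}\to\mathcal{D}$ whose underlying functor is an equivalence of categories. *)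

(* Defs.v *)
From HB Require Import structures.
From mathcomp Require Import all_boot all_algebra.
From mathcomp Require Import boolp classical_sets functions cardinality fsbigop.

Set Implicit Arguments.
Unset Strict Implicit.
Unset Printing Implicit Defensive.

Import GRing.Theory.
Local Open Scope classical_set_scope.
Local Open Scope ring_scope.

Reserved Notation "g \oc f" (at level 40, left associativity).
Reserved Notation "a \ox b" (at level 39, left associativity).
Reserved Notation "f \om g" (at level 39, left associativity).

Record category := Category {
  obj :> Type;
  hom : obj -> obj -> Type;
  idm : forall a, hom a a;
  comp : forall a b c, hom b c -> hom a b -> hom a c;
  compA : forall a b c d (h : hom c d) (g : hom b c) (f : hom a b),
    comp h (comp g f) = comp (comp h g) f;
  comp1m : forall a b (f : hom a b), comp (idm b) f = f;
  compm1 : forall a b (f : hom a b), comp f (idm a) = f }.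

Notation "g \oc f" := (comp g f).

Definition is_iso (C : category) (a b : C) (f : hom a b) : Prop :=
  exists g : hom b a, g \oc f = idm a /\ f \oc g = idm b.

Record functor (C D : category) := Functor {
  fobj :> C -> D;
  fmap : forall a b, hom a b -> hom (fobj a) (fobj b);
  fmap1 : forall a, fmap (idm a) = idm (fobj a);
  fmap_comp : forall a b c (g : hom b c) (f : hom a b),
    fmap (g \oc f) = fmap g \oc fmap f }.

Definition functor_id (C : category) : functor C C :=
  @Functor C C id (fun _ _ f => f) (fun _ => erefl) (fun _ _ _ _ _ => erefl).

Program Definition functor_comp (C D E : category)
    (G : functor D E) (F : functor C D) : functor C E :=
  @Functor C E (G \o F) (fun _ _ f => fmap G (fmap F f)) _ _.
Next Obligation. by rewrite /= !fmap1. Qed.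
Next Obligation. by rewrite /= !fmap_comp. Qed.

Definition naturally_isomorphic (C D : category) (F G : functor C D) : Prop :=
  exists t : forall a, hom (F a) (G a),
    (forall a, is_iso (t a)) /\
    (forall a b (f : hom a b), fmap G f \oc t a = t b \oc fmap F f).

Definition is_equivalence (C D : category) (F : functor C D) : Prop :=
  exists G : functor D C,
    naturally_isomorphic (functor_comp G F) (functor_id C) /\
    naturally_isomorphic (functor_comp F G) (functor_id D).

Record monoidal_structure (C : category) := MonoidalStructure {
  tens_of : C -> C -> C;
  tensm_of : forall a a' b b' : C,
    hom a a' -> hom b b' -> hom (tens_of a b) (tens_of a' b');
  munit_of : C;
  assoc_of : forall a b c,
    hom (tens_of (tens_of a b) c) (tens_of a (tens_of b c));
  runit_of : forall a, hom (tens_of a munit_of) a;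
  lunit_of : forall a, hom (tens_of munit_of a) a;
  _ : forall a b, tensm_of (idm a) (idm b) = idm (tens_of a b);
  _ : forall a a' a'' b b' b'' (f' : hom a' a'') (f : hom a a')
      (g' : hom b' b'') (g : hom b b'),
    tensm_of (f' \oc f) (g' \oc g) = tensm_of f' g' \oc tensm_of f g;
  _ : forall a b c, is_iso (assoc_of a b c);
  _ : forall a, is_iso (runit_of a);
  _ : forall a, is_iso (lunit_of a);
  _ : forall a a' b b' c c' (f : hom a a') (g : hom b b') (h : hom c c'),
    tensm_of f (tensm_of g h) \oc assoc_of a b c =
    assoc_of a' b' c' \oc tensm_of (tensm_of f g) h;
  _ : forall a a' (f : hom a a'),
    f \oc runit_of a = runit_of a' \oc tensm_of f (idm munit_of);
  _ : forall a a' (f : hom a a'),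
    f \oc lunit_of a = lunit_of a' \oc tensm_of (idm munit_of) f;
  _ : forall a b c d,
    tensm_of (idm a) (assoc_of b c d) \oc assoc_of a (tens_of b c) d
      \oc tensm_of (assoc_of a b c) (idm d) =
    assoc_of a b (tens_of c d) \oc assoc_of (tens_of a b) c d;
  _ : forall a b,
    tensm_of (idm a) (lunit_of b) \oc assoc_of a munit_of b =
    tensm_of (runit_of a) (idm b) }.

Record monCategory := MonCategory {
  mcat :> category;
  mstr : monoidal_structure mcat }.

Section MonoidalTheory.
Context (C : monCategory).
Definition tens (a b : C) : C := tens_of (mstr C) a b.
Definition munit : C := munit_of (mstr C).
Definition tensm (a a' b b' : C) (f : hom a a') (g : hom b b') :
  hom (tens a b) (tens a' b') := tensm_of (mstr C) f g.
Definition assoc (a b c : C) : hom (tens (tens a b) c) (tens a (tens b c)) :=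
  assoc_of (mstr C) a b c.
Definition runit (a : C) : hom (tens a munit) a := runit_of (mstr C) a.
Definition lunit (a : C) : hom (tens munit a) a := lunit_of (mstr C) a.

Local Notation "a \ox b" := (tens a b).
Local Notation "f \om g" := (tensm f g).

Lemma tensm1 (a b : C) : idm a \om idm b = idm (a \ox b).
Proof. by rewrite /tensm /tens; case: (mstr C). Qed.
Lemma tensmM (a a' a'' b b' b'' : C) (f' : hom a' a'') (f : hom a a')
    (g' : hom b' b'') (g : hom b b') :
  (f' \oc f) \om (g' \oc g) = (f' \om g') \oc (f \om g).
Proof. by rewrite /tensm /tens; case: (mstr C). Qed.
Lemma assoc_iso (a b c : C) : is_iso (assoc a b c).
Proof. by rewrite /assoc /tens; case: (mstr C). Qed.
Lemma runit_iso (a : C) : is_iso (runit a).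
Proof. by rewrite /runit /tens /munit; case: (mstr C). Qed.
Lemma lunit_iso (a : C) : is_iso (lunit a).
Proof. by rewrite /lunit /tens /munit; case: (mstr C). Qed.
Lemma assoc_nat (a a' b b' c c' : C) (f : hom a a') (g : hom b b')
    (h : hom c c') :
  (f \om (g \om h)) \oc assoc a b c = assoc a' b' c' \oc ((f \om g) \om h).
Proof. by rewrite /assoc /tensm /tens; case: (mstr C). Qed.
Lemma runit_nat (a a' : C) (f : hom a a') :
  f \oc runit a = runit a' \oc (f \om idm munit).
Proof. by rewrite /runit /tensm /tens /munit; case: (mstr C). Qed.
Lemma lunit_nat (a a' : C) (f : hom a a') :
  f \oc lunit a = lunit a' \oc (idm munit \om f).
Proof. by rewrite /lunit /tensm /tens /munit; case: (mstr C). Qed.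
Lemma pentagon (a b c d : C) :
  (idm a \om assoc b c d) \oc assoc a (b \ox c) d \oc (assoc a b c \om idm d)
  = assoc a b (c \ox d) \oc assoc (a \ox b) c d.
Proof. by rewrite /assoc /tensm /tens; case: (mstr C). Qed.
Lemma triangle (a b : C) :
  (idm a \om lunit b) \oc assoc a munit b = runit a \om idm b.
Proof. by rewrite /lunit /runit /assoc /tensm /tens /munit; case: (mstr C). Qed.
End MonoidalTheory.

Arguments munit : clear implicits.
Notation "a \ox b" := (tens a b).
Notation "f \om g" := (tensm f g).

Record tensor_functor (C D : monCategory) := TensorFunctor {
  tfun :> functor C D;
  phi0 : hom (munit D) (tfun (munit C));
  phi2 : forall a b : C, hom (tfun a \ox tfun b) (tfun (a \ox b));
  phi0_iso : is_iso phi0;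
  phi2_iso : forall a b, is_iso (phi2 a b);
  phi2_nat : forall (a a' b b' : C) (f : hom a a') (g : hom b b'),
    fmap tfun (f \om g) \oc phi2 a b = phi2 a' b' \oc (fmap tfun f \om fmap tfun g);
  phi2_assoc : forall a b c : C,
    phi2 a (b \ox c) \oc (idm (tfun a) \om phi2 b c)
      \oc assoc (tfun a) (tfun b) (tfun c) =
    fmap tfun (assoc a b c) \oc phi2 (a \ox b) c \oc (phi2 a b \om idm (tfun c));
  phi2_lunit : forall a : C,
    lunit (tfun a) =
    fmap tfun (lunit a) \oc phi2 (munit C) a \oc (phi0 \om idm (tfun a));
  phi2_runit : forall a : C,
    runit (tfun a) =
    fmap tfun (runit a) \oc phi2 a (munit C) \oc (idm (tfun a) \om phi0) }.

Definition full_subcategory (C : category) (D : set C) : category :=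
  @Category {a : C | D a} (fun a b => hom (sval a) (sval b))
    (fun a => idm (sval a)) (fun _ _ _ g f => g \oc f)
    (fun _ _ _ _ h g f => compA h g f)
    (fun _ _ f => comp1m f) (fun _ _ f => compm1 f).

Section FullMonoidalSubcategory.
Context (C : monCategory) (D : set C) (D1 : D (munit C))
  (DM : forall a b, D a -> D b -> D (a \ox b)).

Definition full_sub_monoidal : monoidal_structure (full_subcategory D) :=
  @MonoidalStructure (full_subcategory D)
    (fun a b => exist _ (sval a \ox sval b) (DM (svalP a) (svalP b)))
    (fun _ _ _ _ f g => f \om g)
    (exist _ (munit C) D1)
    (fun a b c => assoc (sval a) (sval b) (sval c))
    (fun a => runit (sval a)) (fun a => lunit (sval a))
    (fun _ _ => tensm1 _ _) (fun _ _ _ _ _ _ f' f g' g => tensmM f' f g' g)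
    (fun _ _ _ => assoc_iso _ _ _) (fun _ => runit_iso _) (fun _ => lunit_iso _)
    (fun _ _ _ _ _ _ f g h => assoc_nat f g h)
    (fun _ _ f => runit_nat f) (fun _ _ f => lunit_nat f)
    (fun _ _ _ _ => pentagon _ _ _ _) (fun _ _ => triangle _ _).

Definition full_monoidal_subcategory : monCategory :=
  MonCategory full_sub_monoidal.
End FullMonoidalSubcategory.

Record abCategory := AbCategory {
  abobj : Type;
  abhom : abobj -> abobj -> zmodType;
  abid : forall a, abhom a a;
  abcomp : forall a b c, abhom b c -> abhom a b -> abhom a c;
  abcompA : forall a b c d (h : abhom c d) (g : abhom b c) (f : abhom a b),
    abcomp h (abcomp g f) = abcomp (abcomp h g) f;
  abcomp1m : forall a b (f : abhom a b), abcomp (abid b) f = f;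
  abcompm1 : forall a b (f : abhom a b), abcomp f (abid a) = f;
  abcompDl : forall a b c (g g' : abhom b c) (f : abhom a b),
    abcomp (g + g') f = abcomp g f + abcomp g' f;
  abcompDr : forall a b c (g : abhom b c) (f f' : abhom a b),
    abcomp g (f + f') = abcomp g f + abcomp g f' }.

Coercion cat_of_ab (C : abCategory) : category :=
  Category (@abcompA C) (@abcomp1m C) (@abcompm1 C).

HB.instance Definition _ (C : abCategory) (a b : C) :=
  GRing.Zmodule.copy (hom a b) (abhom a b).

Record monAbCategory := MonAbCategory {
  mabcat :> abCategory;
  mabstr : monoidal_structure mabcat;
  tensm_ofDl : forall (a a' b b' : mabcat) (f f' : hom a a') (g : hom b b'),
    tensm_of mabstr (f + f') g = tensm_of mabstr f g + tensm_of mabstr f' g;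
  tensm_ofDr : forall (a a' b b' : mabcat) (f : hom a a') (g g' : hom b b'),
    tensm_of mabstr f (g + g') = tensm_of mabstr f g + tensm_of mabstr f g' }.

Coercion moncat_of_mab (C : monAbCategory) : monCategory :=
  MonCategory (mabstr C).
Canonical moncat_of_mab.

(* Identities between propositionally equal objects: strictness of a monoidal
   category is an equality of objects, so its identity constraints need a cast. *)
Definition eqm (C : category) (a b : C) (e : a = b) : hom a b :=
  let: erefl := e in idm a.

Record is_strict (C : monCategory) : Prop := IsStrict {
  strict_tensA : forall a b c : C, (a \ox b) \ox c = a \ox (b \ox c);
  strict_tens1 : forall a : C, a \ox munit C = a;
  strict_1tens : forall a : C, munit C \ox a = a;
  strict_assoc : forall a b c : C, assoc a b c = eqm (strict_tensA a b c);
  strict_runit : forall a : C, runit a = eqm (strict_tens1 a);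
  strict_lunit : forall a : C, lunit a = eqm (strict_1tens a) }.

Section AbTheory.
Context (C : abCategory).
Implicit Types a b c : C.

Lemma comp_addl a b c (g g' : hom b c) (f : hom a b) :
  (g + g') \oc f = g \oc f + g' \oc f.
Proof. exact: abcompDl. Qed.
Lemma comp_addr a b c (g : hom b c) (f f' : hom a b) :
  g \oc (f + f') = g \oc f + g \oc f'.
Proof. exact: abcompDr. Qed.
Lemma comp0m a b c (f : hom a b) : (0 : hom b c) \oc f = 0.
Proof. by apply: (addrI (0 \oc f)); rewrite -comp_addl !addr0. Qed.
Lemma compm0 a b c (g : hom b c) : g \oc (0 : hom a b) = 0.
Proof. by apply: (addrI (g \oc 0)); rewrite -comp_addr !addr0. Qed.
Lemma comp_suml a b c I (r : seq I) (g : I -> hom b c) (f : hom a b) :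
  (\sum_(i <- r) g i) \oc f = \sum_(i <- r) g i \oc f.
Proof.
by apply: (big_morph (fun h => h \oc f)) => [g1 g2|];
  [exact: comp_addl|exact: comp0m].
Qed.
Lemma comp_sumr a b c I (r : seq I) (g : hom b c) (f : I -> hom a b) :
  g \oc (\sum_(i <- r) f i) = \sum_(i <- r) g \oc f i.
Proof.
by apply: (big_morph (fun h => g \oc h)) => [f1 f2|];
  [exact: comp_addr|exact: compm0].
Qed.
End AbTheory.

Section MonAbTheory.
Context (C : monAbCategory).
Implicit Types a b : C.

Lemma tensm_addl a a' b b' (f f' : hom a a') (g : hom b b') :
  (f + f') \om g = f \om g + f' \om g.
Proof. exact: tensm_ofDl. Qed.
Lemma tensm_addr a a' b b' (f : hom a a') (g g' : hom b b') :
  f \om (g + g') = f \om g + f \om g'.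
Proof. exact: tensm_ofDr. Qed.
Lemma tens0m a a' b b' (g : hom b b') : (0 : hom a a') \om g = 0.
Proof. by apply: (addrI (0 \om g)); rewrite -tensm_addl !addr0. Qed.
Lemma tensm0 a a' b b' (f : hom a a') : f \om (0 : hom b b') = 0.
Proof. by apply: (addrI (f \om 0)); rewrite -tensm_addr !addr0. Qed.
Lemma tensm_suml a a' b b' I (r : seq I) (f : I -> hom a a') (g : hom b b') :
  (\sum_(i <- r) f i) \om g = \sum_(i <- r) f i \om g.
Proof.
by apply: (big_morph (fun h => h \om g)) => [f1 f2|];
  [exact: tensm_addl|exact: tens0m].
Qed.
Lemma tensm_sumr a a' b b' I (r : seq I) (f : hom a a') (g : I -> hom b b') :
  f \om (\sum_(i <- r) g i) = \sum_(i <- r) f \om g i.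
Proof.
by apply: (big_morph (fun h => f \om h)) => [f1 f2|];
  [exact: tensm_addr|exact: tensm0].
Qed.
End MonAbTheory.

Lemma fsum_seq (T : choiceType) (V : zmodType) (u : T -> V) (r : seq T) :
  uniq r -> (forall i, i \notin r -> u i = 0) ->
  \sum_(i \in [set: T]) u i = \sum_(i <- r) u i.
Proof.
move=> ur u0; rewrite (fsbigE r) //=; last by move=> i _; exact: u0.
by apply: eq_bigl => i; rewrite in_setT.
Qed.

Lemma fsum1 (T : choiceType) (V : zmodType) (u : T -> V) (i0 : T) :
  (forall i, i <> i0 -> u i = 0) -> \sum_(i \in [set: T]) u i = u i0.
Proof.
move=> u0; rewrite (@fsum_seq _ _ _ [:: i0]) ?big_seq1 // => i.
by rewrite inE => /eqP; exact: u0.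
Qed.

(* The Kronecker symbol of [P] times an identity morphism; the two endpoints
   coincide only when [P] holds. *)
Definition delta (C : abCategory) (P : Prop) (a b : C) (e : P -> a = b) :
    hom a b :=
  if pselect P is left p then eqm (e p) else 0.

Section DeltaTheory.
Context (C : abCategory).
Implicit Types a b c : C.

Lemma eqm_comp a b c (e' : b = c) (e : a = b) :
  eqm e' \oc eqm e = eqm (etrans e e').
Proof. by case: _ / e'; rewrite comp1m. Qed.

Lemma eqmE a b (e e' : a = b) : eqm e = eqm e'.
Proof. by rewrite (Prop_irrelevance e e'). Qed.

Lemma deltaT (P : Prop) a b (e : P -> a = b) (p : P) : delta e = eqm (e p).
Proof. by rewrite /delta; case: pselect => // q; exact: eqmE. Qed.

Lemma deltaF (P : Prop) a b (e : P -> a = b) : ~ P -> delta e = 0.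
Proof. by rewrite /delta; case: pselect. Qed.

Lemma delta_ext (P Q : Prop) a b (e : P -> a = b) (e' : Q -> a = b) :
  (P <-> Q) -> delta e = delta e'.
Proof.
move=> PQ; have [q|nq] := pselect Q.
  by rewrite (deltaT e (PQ.2 q)) (deltaT e' q); exact: eqmE.
by rewrite !deltaF // => /PQ.1.
Qed.

Lemma delta_comp (P Q : Prop) a b c (e : P -> a = b) (e' : Q -> b = c) :
  delta e' \oc delta e
  = delta (fun pq : P /\ Q => etrans (e pq.1) (e' pq.2)).
Proof.
have [p|np] := pselect P; last first.
  by rewrite (deltaF e) // compm0 deltaF // => -[].
have [q|nq] := pselect Q; last first.
  by rewrite (deltaF e') // comp0m deltaF // => -[].
by rewrite (deltaT e p) (deltaT e' q) (deltaT _ (conj p q)) eqm_comp; exact: eqmE.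
Qed.
End DeltaTheory.

Lemma eqm_tens (C : monCategory) (a a' b b' : C) (e : a = a') (e' : b = b') :
  eqm e \om eqm e' = eqm (congr2 (@tens C) e e').
Proof. by destruct e, e'; rewrite tensm1 (Prop_irrelevance (congr2 _ _ _) erefl). Qed.

Lemma delta_tens (C : monAbCategory) (P Q : Prop) (a a' b b' : C)
    (e : P -> a = a') (e' : Q -> b = b') :
  delta e \om delta e'
  = delta (fun pq : P /\ Q => congr2 (@tens C) (e pq.1) (e' pq.2)).
Proof.
have [p|np] := pselect P; last first.
  by rewrite (deltaF e) // tens0m deltaF // => -[].
have [q|nq] := pselect Q; last first.
  by rewrite (deltaF e') // tensm0 deltaF // => -[].
by rewrite (deltaT e p) (deltaT e' q) (deltaT _ (conj p q)) eqm_tens; exact: eqmE.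
Qed.

Record pfamily (C : Type) (S0 : Type) := PFamily {
  supp : set S0;
  pfun :> supp -> C }.

Section MatrixCategory.
Context (C : abCategory) (S0 : choiceType).
Implicit Types f g h : pfamily C S0.

Definition row_finite f g (F : forall (x : supp f) (y : supp g), hom (f x) (g y))
    : Prop :=
  infinite_set (supp g) ->
  forall x, exists2 A : set (supp g), finite_set A & forall y, ~ A y -> F x y = 0.

Record matrix_hom f g := MatrixHom {
  entry :> forall (x : supp f) (y : supp g), hom (f x) (g y);
  entry_finite : row_finite entry }.

Lemma matrix_homP f g (F G : matrix_hom f g) : (forall x y, F x y = G x y) -> F = G.
Proof.
move=> FG; have : entry F = entry G.
  apply: functional_extensionality_dep => x.
  by apply: functional_extensionality_dep => y.
case: F G {FG} => [F pF] [G pG] /= FG; case: _ / FG in pG *.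
by rewrite (Prop_irrelevance pF pG).
Qed.

Lemma row_finiteP f g (F : forall (x : supp f) (y : supp g), hom (f x) (g y)) :
  row_finite F <->
  forall x, exists2 r : seq (supp g), uniq r & forall y, y \notin r -> F x y = 0.
Proof.
split=> [rF x|rF _ x]; last first.
  have [r _ r0] := rF x; exists [set` r]; first exact: finite_seq.
  by move=> y /negP; exact: r0.
have [A fA A0] : exists2 A : set (supp g), finite_set A &
    forall y, ~ A y -> F x y = 0.
  have [fg|ig] := pselect (finite_set (supp g)); last exact: (rF ig).
  exists setT; last by move=> y /(_ I).
  have [r gr] := (finite_seqP _).1 fg.
  apply/finite_seqP; exists (pmap insub r); apply/seteqP; split=> // y _ /=.
  have yr : [set` r] (sval y) by rewrite -gr; exact: (set_mem (svalP y)).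
  by rewrite mem_pmap_sub.
have [r Ar] := (finite_seqP _).1 fA.
exists (undup r); first exact: undup_uniq.
by move=> y; rewrite mem_undup => yr; apply: A0; rewrite Ar; exact/negP.
Qed.

Definition matrix_comp_fun f g h (G : matrix_hom g h) (F : matrix_hom f g)
    (x : supp f) (y : supp h) : hom (f x) (h y) :=
  \sum_(z \in [set: supp g]) (G z y \oc F x z).

Lemma matrix_comp_finite f g h (G : matrix_hom g h) (F : matrix_hom f g) :
  row_finite (matrix_comp_fun G F).
Proof.
apply/row_finiteP => x.
have [r ur r0] := (row_finiteP F).1 (@entry_finite _ _ F) x.
have [s sP] : exists s : supp g -> seq (supp h),
    forall z y, y \notin s z -> G z y = 0.
  have /choice [s sP] : forall z, exists s : seq (supp h),
      forall y, y \notin s -> G z y = 0.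
    by move=> z; have [s _ s0] := (row_finiteP G).1 (@entry_finite _ _ G) z; exists s.
  by exists s.
exists (undup (flatten (map s r))); first exact: undup_uniq.
move=> y; rewrite mem_undup => /flatten_mapP yr.
rewrite /matrix_comp_fun (fsum_seq ur) => [|z zr]; last by rewrite r0 ?compm0.
rewrite big_seq big1 // => z zr; rewrite sP ?comp0m //.
by apply/negP => ys; apply: yr; exists z.
Qed.

Definition matrix_comp f g h (G : matrix_hom g h) (F : matrix_hom f g) :
    matrix_hom f h :=
  MatrixHom (matrix_comp_finite G F).

Lemma delta_finite f g (R : supp f -> supp g -> Prop)
    (e : forall x y, R x y -> f x = g y) :
  (forall x y y', R x y -> R x y' -> y = y') ->
  row_finite (fun x y => delta (e x y)).
Proof.
move=> Rfun; apply/row_finiteP => x.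
have [[y0 Ry0]|nR] := pselect (exists y, R x y).
  exists [:: y0] => // y; rewrite inE => /eqP yy0.
  by rewrite deltaF // => Ry; apply: yy0; exact: Rfun Ry Ry0.
by exists [::] => // y _; rewrite deltaF // => Ry; apply: nR; exists y.
Qed.

Definition delta_matrix f g (R : supp f -> supp g -> Prop)
    (e : forall x y, R x y -> f x = g y)
    (Rfun : forall x y y', R x y -> R x y' -> y = y') : matrix_hom f g :=
  MatrixHom (delta_finite e Rfun).

Definition matrix_id f : matrix_hom f f :=
  @delta_matrix f f (fun x y => x = y) (fun x y e => congr1 f e)
    (fun x y y' e e' => etrans (esym e) e').

Lemma comp_row1 f g h (G : matrix_hom g h) (F : matrix_hom f g) x y z :
  (forall z', z' <> z -> F x z' = 0) ->
  matrix_comp G F x y = G z y \oc F x z.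
Proof. by move=> F0; apply: fsum1 => z' zz'; rewrite F0 // compm0. Qed.

Lemma comp_col1 f g h (G : matrix_hom g h) (F : matrix_hom f g) x y z :
  (forall z', z' <> z -> G z' y = 0) ->
  matrix_comp G F x y = G z y \oc F x z.
Proof. by move=> G0; apply: fsum1 => z' zz'; rewrite G0 // comp0m. Qed.

Lemma matrix_comp_seq f g h (G : matrix_hom g h) (F : matrix_hom f g) x y r :
  uniq r -> (forall z, z \notin r -> F x z = 0) ->
  matrix_comp G F x y = \sum_(z <- r) (G z y \oc F x z).
Proof. by move=> ur r0; apply: fsum_seq => // z zr; rewrite r0 // compm0. Qed.

Lemma matrix_compA f g h k (H : matrix_hom h k) (G : matrix_hom g h)
    (F : matrix_hom f g) :
  matrix_comp H (matrix_comp G F) = matrix_comp (matrix_comp H G) F.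
Proof.
apply: matrix_homP => x y.
have [r ur r0] := (row_finiteP F).1 (@entry_finite _ _ F) x.
have [s sP] : exists s : supp g -> seq (supp h),
    forall z y, y \notin s z -> G z y = 0.
  have /choice [s sP] : forall z, exists s : seq (supp h),
      forall y, y \notin s -> G z y = 0.
    by move=> z; have [s _ s0] := (row_finiteP G).1 (@entry_finite _ _ G) z; exists s.
  by exists s.
set t := undup (flatten (map s r)).
have Gt z w : z \in r -> w \notin t -> G z w = 0.
  move=> zr wt; apply: sP; apply: contra wt => ws.
  by rewrite mem_undup; apply/flatten_mapP; exists z.
rewrite (@matrix_comp_seq _ _ _ _ _ x y t) ?undup_uniq //; last first.
  move=> w wt; rewrite (matrix_comp_seq _ _ ur r0) big_seq big1 // => z zr.
  by rewrite (Gt _ _ zr wt) comp0m.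
rewrite (matrix_comp_seq _ _ ur r0).
under eq_bigr do rewrite (matrix_comp_seq _ _ ur r0) comp_sumr.
rewrite exchange_big big_seq [RHS]big_seq; apply: eq_bigr => z zr.
rewrite (@matrix_comp_seq _ _ _ _ _ z y t) ?undup_uniq //; last by move=> w; exact: Gt.
by rewrite comp_suml; apply: eq_bigr => w _; rewrite compA.
Qed.

Lemma matrix_idxx f (x : supp f) : matrix_id f x x = idm (f x).
Proof. exact: (deltaT _ (erefl x)). Qed.

Lemma matrix_id0 f (x y : supp f) : x <> y -> matrix_id f x y = 0.
Proof. exact: deltaF. Qed.

Lemma matrix_comp1m f g (F : matrix_hom f g) : matrix_comp (matrix_id g) F = F.
Proof.
apply: matrix_homP => x y; rewrite (comp_col1 _ _ (z := y)).
  by rewrite matrix_idxx comp1m.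
by move=> z; exact: matrix_id0.
Qed.

Lemma matrix_compm1 f g (F : matrix_hom f g) : matrix_comp F (matrix_id f) = F.
Proof.
apply: matrix_homP => x y; rewrite (comp_row1 _ _ (z := x)).
  by rewrite matrix_idxx compm1.
by move=> z /nesym; exact: matrix_id0.
Qed.

Definition matrix_category : category :=
  Category matrix_compA matrix_comp1m matrix_compm1.

End MatrixCategory.

(* For s = gamma (x, y) in gamma (A * B), [sfst s] and [ssnd s] are x and y,
   which are unique because gamma is injective. *)
Section SupportPairing.
Context (S0 : choiceType) (gamma : S0 * S0 -> S0) (gammaB : bijective gamma).
Context (A B : set S0).
Implicit Types (s : gamma @` (A `*` B)) (x : A) (y : B).

Fact spair_subproof x y : gamma (val x, val y) \in gamma @` (A `*` B).
Proof.
apply/mem_set; exists (val x, val y) => //.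
by split; [exact: (set_mem (svalP x))|exact: (set_mem (svalP y))].
Qed.

Definition spair x y : gamma @` (A `*` B) :=
  exist (fun z => z \in gamma @` (A `*` B)) _ (spair_subproof x y).

Fact sunpair_subproof s : exists p : A * B, gamma (val p.1, val p.2) = val s.
Proof.
have [[x y] [/= Ax By] <-] := set_mem (svalP s).
by exists (exist _ x (mem_set Ax), exist _ y (mem_set By)).
Qed.

Definition sfst s : A := (projT1 (cid (sunpair_subproof s))).1.
Definition ssnd s : B := (projT1 (cid (sunpair_subproof s))).2.

Lemma gamma_sunpair s : gamma (val (sfst s), val (ssnd s)) = val s.
Proof. by rewrite /sfst /ssnd; case: cid. Qed.

Lemma sunpairK s : spair (sfst s) (ssnd s) = s.
Proof. by apply: val_inj; exact: gamma_sunpair. Qed.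

Lemma sfst_pair x y : sfst (spair x y) = x.
Proof.
by apply: val_inj; have /(bij_inj gammaB) [] := gamma_sunpair (spair x y).
Qed.

Lemma ssnd_pair x y : ssnd (spair x y) = y.
Proof.
by apply: val_inj; have /(bij_inj gammaB) [] := gamma_sunpair (spair x y).
Qed.

Lemma spair_inj x y x' y' :
  spair x y = spair x' y' -> x = x' /\ y = y'.
Proof.
move=> e; split; first by have := congr1 sfst e; rewrite !sfst_pair.
by have := congr1 ssnd e; rewrite !ssnd_pair.
Qed.

Lemma sunpair_inj s s' : sfst s = sfst s' -> ssnd s = ssnd s' -> s = s'.
Proof. by move=> e1 e2; rewrite -(sunpairK s) -(sunpairK s') e1 e2. Qed.
End SupportPairing.

Section MatrixMonoidal.
Context (C : monAbCategory) (strictC : is_strict C) (S0 : choiceType).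
Context (gamma : S0 * S0 -> S0) (gammaB : bijective gamma) (star : S0).
Implicit Types f g h k : pfamily C S0.

Definition ptens f g : pfamily C S0 :=
  PFamily (fun s : gamma @` (supp f `*` supp g) => f (sfst s) \ox g (ssnd s)).

Definition punit : pfamily C S0 :=
  PFamily (fun _ : [set star] => munit C).

Lemma ptensE f g (x : supp f) (y : supp g) :
  ptens f g (spair gamma x y) = f x \ox g y.
Proof. by rewrite /= sfst_pair ?ssnd_pair. Qed.

Lemma punit_uniq (x y : supp punit) : x = y.
Proof.
have xs : val x = star := set_mem (svalP x).
have ys : val y = star := set_mem (svalP y).
by apply: val_inj; rewrite xs ys.
Qed.

Lemma ptensm_finite f f' g g' (F : matrix_hom f f') (G : matrix_hom g g') :
  @row_finite C S0 (ptens f g) (ptens f' g')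
    (fun s t => F (sfst s) (sfst t) \om G (ssnd s) (ssnd t)).
Proof.
apply/row_finiteP => s.
have [q uq q0] := (row_finiteP F).1 (@entry_finite _ _ _ _ F) (sfst s).
have [r ur r0] := (row_finiteP G).1 (@entry_finite _ _ _ _ G) (ssnd s).
exists (undup [seq spair gamma x y | x <- q, y <- r]); first exact: undup_uniq.
move=> t; rewrite mem_undup => tqr.
have [xq|/q0->] := boolP (sfst t \in q); last exact: tens0m.
have [yr|/r0->] := boolP (ssnd t \in r); last exact: tensm0.
by move: tqr; rewrite -(sunpairK t) allpairs_f.
Qed.

Definition ptensm f f' g g' (F : matrix_hom f f') (G : matrix_hom g g') :
    matrix_hom (ptens f g) (ptens f' g') :=
  MatrixHom (ptensm_finite F G).

(* For s = gamma (gamma (x, y), z) and t = gamma (x', gamma (y', z')), the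
   relation below says that x = x', y = y' and z = z'. *)
Definition passoc f g h :
    matrix_hom (ptens (ptens f g) h) (ptens f (ptens g h)) :=
  @delta_matrix C S0 (ptens (ptens f g) h) (ptens f (ptens g h))
    (fun s t => [/\ sfst (sfst s) = sfst t, ssnd (sfst s) = sfst (ssnd t)
                  & ssnd s = ssnd (ssnd t)])
    (fun s t '(And3 e1 e2 e3) =>
       etrans (strict_tensA strictC _ _ _)
         (congr2 (@tens C) (congr1 f e1)
            (congr2 (@tens C) (congr1 g e2) (congr1 h e3))))
    (fun s t t' '(And3 e1 e2 e3) '(And3 e1' e2' e3') =>
       sunpair_inj (etrans (esym e1) e1')
         (sunpair_inj (etrans (esym e2) e2') (etrans (esym e3) e3'))).

Definition prunit f : matrix_hom (ptens f punit) f :=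
  @delta_matrix C S0 (ptens f punit) f
    (fun s x => sfst s = x)
    (fun s x e => etrans (strict_tens1 strictC _) (congr1 f e))
    (fun s x x' e e' => etrans (esym e) e').

Definition plunit f : matrix_hom (ptens punit f) f :=
  @delta_matrix C S0 (ptens punit f) f
    (fun s x => ssnd s = x)
    (fun s x e => etrans (strict_1tens strictC _) (congr1 f e))
    (fun s x x' e e' => etrans (esym e) e').

Lemma ptensm1 f g : ptensm (matrix_id f) (matrix_id g) = matrix_id (ptens f g).
Proof.
apply: matrix_homP => s t; rewrite /= delta_tens; apply: delta_ext.
by split=> [[]|->//]; exact: sunpair_inj.
Qed.

Lemma ptensmM f f' f'' g g' g'' (F' : matrix_hom f' f'') (F : matrix_hom f f')
    (G' : matrix_hom g' g'') (G : matrix_hom g g') :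
  ptensm (matrix_comp F' F) (matrix_comp G' G) =
  matrix_comp (ptensm F' G') (ptensm F G).
Proof.
apply: matrix_homP => s t.
have [q uq q0] := (row_finiteP F).1 (@entry_finite _ _ _ _ F) (sfst s).
have [r ur r0] := (row_finiteP G).1 (@entry_finite _ _ _ _ G) (ssnd s).
have up : uniq [seq spair gamma x y | x <- q, y <- r].
  by apply: allpairs_uniq => // -[x y] [x' y'] _ _ /= /spair_inj[] // -> ->.
rewrite (@matrix_comp_seq _ _ _ (ptens f' g') _ _ _ _ _ _ up); last first.
  move=> u uqr /=.
  have [xq|/q0->] := boolP (sfst u \in q); last exact: tens0m.
  have [yr|/r0->] := boolP (ssnd u \in r); last exact: tensm0.
  by move: uqr; rewrite -(sunpairK u) allpairs_f.
transitivity (matrix_comp F' F (sfst s) (sfst t) \om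
  matrix_comp G' G (ssnd s) (ssnd t)); first by [].
rewrite (matrix_comp_seq _ _ uq q0) (matrix_comp_seq _ _ ur r0).
rewrite big_allpairs_dep tensm_suml; apply: eq_bigr => x _.
rewrite tensm_sumr; apply: eq_bigr => y _.
set u := spair _ _ _.
transitivity ((F' (sfst u) (sfst t) \om G' (ssnd u) (ssnd t)) \oc
  (F (sfst s) (sfst u) \om G (ssnd s) (ssnd u))); last by [].
by rewrite -tensmM /u !sfst_pair // !ssnd_pair.
Qed.

(* A matrix whose entries are the identities of the pairs of indices related by
   the graph of a partial function, and zero elsewhere. *)
Definition is_delta f g (R : supp f -> supp g -> Prop) (M : matrix_hom f g) :=
  (forall x y y', R x y -> R x y' -> y = y') /\
  (forall x y, exists e : R x y -> f x = g y, M x y = delta e).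

Lemma is_delta_ext f g (R R' : supp f -> supp g -> Prop) (M M' : matrix_hom f g) :
  is_delta R M -> is_delta R' M' -> (forall x y, R x y <-> R' x y) -> M = M'.
Proof.
move=> [_ RM] [_ RM'] RR'; apply: matrix_homP => x y.
by have [e ->] := RM x y; have [e' ->] := RM' x y; exact: delta_ext.
Qed.

Lemma is_delta_matrix f g (R : supp f -> supp g -> Prop)
    (e : forall x y, R x y -> f x = g y)
    (Rfun : forall x y y', R x y -> R x y' -> y = y') :
  is_delta R (delta_matrix e Rfun).
Proof. by split=> // x y; exists (e x y). Qed.

Lemma is_delta_id f : is_delta eq (matrix_id f).
Proof. exact: is_delta_matrix. Qed.

Lemma is_delta_comp f g h (R : supp f -> supp g -> Prop)
    (R' : supp g -> supp h -> Prop) (M : matrix_hom f g) (N : matrix_hom g h) :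
  is_delta R M -> is_delta R' N ->
  is_delta (fun x y => exists2 z, R x z & R' z y) (matrix_comp N M).
Proof.
move=> [Rf RM] [Rf' RN]; split=> [x y y' [z xz zy] [z' xz' zy']|x y].
  by rewrite (Rf _ _ _ xz' xz) in zy'; exact: Rf' zy zy'.
have E : (exists2 z, R x z & R' z y) -> f x = h y.
  case=> z xz zy; have [e _] := RM x z; have [e' _] := RN z y.
  exact: etrans (e xz) (e' zy).
exists E; have [[z xz]|nx] := pselect (exists z, R x z); last first.
  rewrite deltaF => [|[z xz _]]; last by apply: nx; exists z.
  rewrite [LHS](@fsum_seq _ _ _ [::]) ?big_nil // => z _.
  have [e ->] := RM x z; rewrite (deltaF e) ?compm0 // => xz.
  by apply: nx; exists z.
rewrite (comp_row1 _ _ (z := z)); last first.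
  move=> z' zz'; have [e ->] := RM x z'; apply: deltaF => xz'.
  by apply: zz'; exact: Rf xz' xz.
have [e ->] := RM x z; have [e' ->] := RN z y; rewrite delta_comp.
apply: delta_ext; split=> [[_ zy]|[z' xz' zy]]; first by exists z.
by rewrite (Rf _ _ _ xz xz').
Qed.

Lemma is_delta_tens f f' g g' (R : supp f -> supp f' -> Prop)
    (R' : supp g -> supp g' -> Prop) (M : matrix_hom f f') (N : matrix_hom g g') :
  is_delta R M -> is_delta R' N ->
  is_delta (fun (s : supp (ptens f g)) (t : supp (ptens f' g')) =>
    R (sfst s) (sfst t) /\ R' (ssnd s) (ssnd t)) (ptensm M N).
Proof.
move=> [Rf RM] [Rf' RN]; split=> [s t t' [e1 e2] [e1' e2']|s t].
  by apply: sunpair_inj; [exact: Rf e1 e1'|exact: Rf' e2 e2'].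
have [e eM] := RM (sfst s) (sfst t); have [e' eN] := RN (ssnd s) (ssnd t).
by eexists; rewrite /= eM eN delta_tens.
Qed.

Lemma is_delta_iso f g (R : supp f -> supp g -> Prop) (M : matrix_hom f g) :
  is_delta R M -> (forall x x' y, R x y -> R x' y -> x = x') ->
  (forall x, exists y, R x y) -> (forall y, exists x, R x y) ->
  @is_iso (matrix_category C S0) f g M.
Proof.
move=> RM Rinj Rtot Rsurj.
have E y x : R x y -> g y = f x by have [e _] := RM.2 x y; move/e/esym.
have RN := is_delta_matrix E (fun y x x' => @Rinj x x' y).
exists (delta_matrix E (fun y x x' => @Rinj x x' y)); split.
  apply: is_delta_ext (is_delta_comp RM RN) (is_delta_id f) _ => x x'.
  split=> [[y]|->]; first exact: Rinj.
  by have [y xy] := Rtot x'; exists y.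
apply: is_delta_ext (is_delta_comp RN RM) (is_delta_id g) _ => y y'.
split=> [[x]|->]; first exact: RM.1.
by have [x xy] := Rsurj y'; exists x.
Qed.

Definition assoc_rel f g h (s : supp (ptens (ptens f g) h))
    (t : supp (ptens f (ptens g h))) : Prop :=
  [/\ sfst (sfst s) = sfst t, ssnd (sfst s) = sfst (ssnd t)
     & ssnd s = ssnd (ssnd t)].

Lemma is_delta_assoc f g h : is_delta (@assoc_rel f g h) (passoc f g h).
Proof. exact: is_delta_matrix. Qed.

Lemma is_delta_runit f :
  is_delta (fun (s : supp (ptens f punit)) x => sfst s = x) (prunit f).
Proof. exact: is_delta_matrix. Qed.

Lemma is_delta_lunit f :
  is_delta (fun (s : supp (ptens punit f)) x => ssnd s = x) (plunit f).
Proof. exact: is_delta_matrix. Qed.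

Lemma assoc_rel_total f g h s : exists t, @assoc_rel f g h s t.
Proof.
exists (spair gamma (sfst (sfst s)) (spair gamma (ssnd (sfst s)) (ssnd s))).
by split; rewrite ?ssnd_pair // sfst_pair.
Qed.

Lemma assoc_rel_surj f g h t : exists s, @assoc_rel f g h s t.
Proof.
exists (spair gamma (spair gamma (sfst t) (sfst (ssnd t))) (ssnd (ssnd t))).
by split; rewrite ?ssnd_pair // sfst_pair // ?sfst_pair // ssnd_pair.
Qed.

Lemma assoc_rel_inj f g h s s' t :
  @assoc_rel f g h s t -> assoc_rel s' t -> s = s'.
Proof.
move=> [e1 e2 e3] [e1' e2' e3']; apply: sunpair_inj; last by rewrite e3.
by apply: sunpair_inj; rewrite ?e1 ?e2.
Qed.

Lemma passoc_iso f g h :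
  @is_iso (matrix_category C S0) _ _ (passoc f g h).
Proof.
apply: is_delta_iso (is_delta_assoc f g h) _ _ _.
- exact: assoc_rel_inj.
- exact: assoc_rel_total.
- exact: assoc_rel_surj.
Qed.

Fact star_subproof : star \in [set star]. Proof. exact/mem_set. Qed.

Definition pstar : supp punit :=
  exist (fun z => z \in [set star]) star star_subproof.

Lemma prunit_iso f : @is_iso (matrix_category C S0) _ _ (prunit f).
Proof.
apply: is_delta_iso (is_delta_runit f) _ _ _ => [s s' x <- e|s|x].
- by apply: sunpair_inj => //; exact: punit_uniq.
- by eexists.
- by exists (spair gamma x pstar); exact: sfst_pair.
Qed.

Lemma plunit_iso f : @is_iso (matrix_category C S0) _ _ (plunit f).
Proof.
apply: is_delta_iso (is_delta_lunit f) _ _ _ => [s s' x <- e|s|x].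
- by apply: sunpair_inj => //; exact: punit_uniq.
- by eexists.
- by exists (spair gamma pstar x); exact: ssnd_pair.
Qed.

Lemma eqm_assoc_nat f f' g g' h h' (F : matrix_hom f f') (G : matrix_hom g g')
    (H : matrix_hom h h') x x1 y y1 z z1 x' x1' y' y1' z' z1'
    (E : (f x \ox g y) \ox h z = f x1 \ox (g y1 \ox h z1))
    (E' : (f' x1' \ox g' y1') \ox h' z1' = f' x' \ox (g' y' \ox h' z')) :
  x = x1 -> y = y1 -> z = z1 -> x1' = x' -> y1' = y' -> z1' = z' ->
  (F x1 x' \om (G y1 y' \om H z1 z')) \oc eqm E =
  eqm E' \oc ((F x x1' \om G y y1') \om H z z1').
Proof.
move=> ? ? ? ? ? ?; subst.
rewrite (eqmE E (strict_tensA strictC _ _ _)).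
rewrite (eqmE E' (strict_tensA strictC _ _ _)) -!strict_assoc.
exact: assoc_nat.
Qed.

Lemma passoc_nat f f' g g' h h' (F : matrix_hom f f') (G : matrix_hom g g')
    (H : matrix_hom h h') :
  matrix_comp (ptensm F (ptensm G H)) (passoc f g h) =
  matrix_comp (passoc f' g' h') (ptensm (ptensm F G) H).
Proof.
apply: matrix_homP => s t.
have [u su] := assoc_rel_total s; have [v vt] := assoc_rel_surj t.
rewrite (comp_row1 _ _ (z := u)); last first.
  move=> u' uu'; apply: deltaF => su'; apply: uu'.
  exact: (is_delta_assoc f g h).1 su' su.
rewrite (@comp_col1 _ _ _ _ _ _ _ _ _ v); last first.
  move=> v' vv'; apply: deltaF => vt'; apply: vv'.
  exact: assoc_rel_inj vt' vt.
have -> : passoc f g h s u = eqm _ := deltaT _ su.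
have -> : passoc f' g' h' v t = eqm _ := deltaT _ vt.
by case: su vt => ? ? ? [? ? ?]; exact: eqm_assoc_nat.
Qed.

Lemma eqm_runit_nat f f' (F : matrix_hom f f') x x1 x' x1' (w w' : supp punit)
    (E : f x \ox munit C = f x1) (E' : f' x1' \ox munit C = f' x') :
  x = x1 -> x1' = x' ->
  F x1 x' \oc eqm E = eqm E' \oc (F x x1' \om matrix_id punit w w').
Proof.
move=> ? ?; subst; rewrite (punit_uniq w w') matrix_idxx.
rewrite (eqmE E (strict_tens1 strictC _)).
rewrite (eqmE E' (strict_tens1 strictC _)) -!strict_runit.
exact: runit_nat.
Qed.

Lemma eqm_lunit_nat f f' (F : matrix_hom f f') x x1 x' x1' (w w' : supp punit)
    (E : munit C \ox f x = f x1) (E' : munit C \ox f' x1' = f' x') :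
  x = x1 -> x1' = x' ->
  F x1 x' \oc eqm E = eqm E' \oc (matrix_id punit w w' \om F x x1').
Proof.
move=> ? ?; subst; rewrite (punit_uniq w w') matrix_idxx.
rewrite (eqmE E (strict_1tens strictC _)).
rewrite (eqmE E' (strict_1tens strictC _)) -!strict_lunit.
exact: lunit_nat.
Qed.

Lemma prunit_nat f f' (F : matrix_hom f f') :
  matrix_comp F (prunit f) =
  matrix_comp (prunit f') (ptensm F (matrix_id punit)).
Proof.
apply: matrix_homP => s x.
rewrite (comp_row1 _ _ (z := sfst s)); last first.
  by move=> z /nesym; exact: deltaF.
pose v : supp (ptens f' punit) := spair gamma x pstar.
have vx : sfst v = x by exact: sfst_pair.
rewrite (@comp_col1 _ _ _ _ _ _ _ _ _ v); last first.
  move=> v' vv'; apply: deltaF => vx'; apply: vv'.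
  by apply: sunpair_inj; [rewrite vx|exact: punit_uniq].
have -> : prunit f s (sfst s) = eqm _ := deltaT _ erefl.
have -> : prunit f' v x = eqm _ := deltaT _ vx.
exact: eqm_runit_nat.
Qed.

Lemma plunit_nat f f' (F : matrix_hom f f') :
  matrix_comp F (plunit f) =
  matrix_comp (plunit f') (ptensm (matrix_id punit) F).
Proof.
apply: matrix_homP => s x.
rewrite (comp_row1 _ _ (z := ssnd s)); last first.
  by move=> z /nesym; exact: deltaF.
pose v : supp (ptens punit f') := spair gamma pstar x.
have vx : ssnd v = x by exact: ssnd_pair.
rewrite (@comp_col1 _ _ _ _ _ _ _ _ _ v); last first.
  move=> v' vv'; apply: deltaF => vx'; apply: vv'.
  by apply: sunpair_inj; [exact: punit_uniq|rewrite vx].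
have -> : plunit f s (ssnd s) = eqm _ := deltaT _ erefl.
have -> : plunit f' v x = eqm _ := deltaT _ vx.
exact: eqm_lunit_nat.
Qed.

Lemma ppentagon f g h k :
  matrix_comp
    (matrix_comp (ptensm (matrix_id f) (passoc g h k)) (passoc f (ptens g h) k))
    (ptensm (passoc f g h) (matrix_id k)) =
  matrix_comp (passoc f g (ptens h k)) (passoc (ptens f g) h k).
Proof.
apply: (is_delta_ext
  (is_delta_comp (is_delta_tens (is_delta_assoc f g h) (is_delta_id k))
    (is_delta_comp (is_delta_assoc f (ptens g h) k)
      (is_delta_tens (is_delta_id f) (is_delta_assoc g h k))))
  (is_delta_comp (is_delta_assoc (ptens f g) h k)
    (is_delta_assoc f g (ptens h k)))) => s t; split.
  move=> [u [[a1 a2 a3] a4] [v [b1 b2 b3] [c1 [c2 c3 c4]]]].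
  have [w sw] := assoc_rel_total s; exists w => //; case: sw => d1 d2 d3.
  split.
  - by rewrite -d1 a1 b1 c1.
  - by rewrite -d1 a2 b2 c2.
  - by apply: sunpair_inj; [rewrite -d2 a3 b2 c3|rewrite -d3 a4 b3 c4].
move=> [w [a1 a2 a3] [b1 b2 b3]].
have [p sp] := assoc_rel_total (sfst s).
pose u : supp (ptens (ptens f (ptens g h)) k) := spair gamma p (ssnd s).
have [v uv] := assoc_rel_total u.
have u1 : sfst u = p by exact: sfst_pair.
have u2 : ssnd u = ssnd s by exact: ssnd_pair.
exists u; first by rewrite /= u1 u2.
exists v => //; case: uv sp => c1 c2 c3 [d1 d2 d3]; rewrite /= -c1 u1 -d1.
split; first by rewrite a1 b1.
by split; rewrite -?c2 -?c3 ?u1 ?u2 -?d2 -?d3 ?a1 ?a2 ?a3 ?b2 // b3.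
Qed.

Lemma ptriangle f g :
  matrix_comp (ptensm (matrix_id f) (plunit g)) (passoc f punit g) =
  ptensm (prunit f) (matrix_id g).
Proof.
apply: (is_delta_ext
  (is_delta_comp (is_delta_assoc f punit g)
    (is_delta_tens (is_delta_id f) (is_delta_lunit g)))
  (is_delta_tens (is_delta_runit f) (is_delta_id g))) => s t; split.
  by move=> [u [a1 a2 a3] [b1 b2]]; rewrite /= a1 a3.
move=> [a b]; have [u su] := assoc_rel_total s; exists u => //.
by case: su => c1 c2 c3; rewrite -c1 -c3.
Qed.

Definition matrix_monoidal : monoidal_structure (matrix_category C S0) :=
  @MonoidalStructure (matrix_category C S0) ptens ptensm punit
    passoc prunit plunit
    ptensm1 ptensmM passoc_iso prunit_iso plunit_iso
    passoc_nat prunit_nat plunit_nat ppentagon ptriangle.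

Definition matrix_monCategory : monCategory := MonCategory matrix_monoidal.

End MatrixMonoidal.

(* Main.v *)
Require Import Defs.
From mathcomp Require Import all_boot all_algebra.
From mathcomp Require Import boolp classical_sets functions cardinality fsbigop.

(** The full subcategory is that of the families whose support is a single
    point. Between two such families a morphism is a one by one matrix, that is,
    a morphism of [C], and the sum defining a composite has a single term
    ([comp_point]). So evaluating a family at its only point is a functor to [C]
    ([eval_functor]), quasi-inverse to the functor which places an object of [C]
    at [star] ([point_functor]).

    The latter functor preserves the unit on the nose. It preserves tensor
    products only up to isomorphism, since the point [gamma (star, star)]
    supporting the tensor product of two families placed at [star] need not be
    [star]: the constraint [point_phi2] is the identity matrix from the former
    point to the latter. The Kronecker symbols which define the associativity and
    unit constraints of matrices are, on these families, the constraints of the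
    strict category [C] ([assoc_point_entry], [lunit_point_entry],
    [runit_point_entry]), so that each side of a coherence condition has for only
    entry the same constraint of [C] composed with identities. *)

Set Implicit Arguments.
Unset Strict Implicit.
Unset Printing Implicit Defensive.

Import Defs.

Local Open Scope classical_set_scope.

(** * Matrices between families with a one-point support *)

Section OnePoint.
Context (C : abCategory) (S0 : choiceType).
Implicit Types f g h : pfamily C S0.

Definition one_point f : Prop := exists p : supp f, forall x, x = p.

Lemma one_point_row_finite f g
    (F : forall (x : supp f) (y : supp g), hom (f x) (g y)) :
  one_point g -> row_finite F.
Proof.
move=> [q qU]; apply/row_finiteP => x; exists [:: q] => // y.
by rewrite inE (qU y) eqxx.
Qed.

Definition point_matrix f g (g1 : one_point g)
    (F : forall (x : supp f) (y : supp g), hom (f x) (g y)) : matrix_hom f g :=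
  MatrixHom (one_point_row_finite F g1).

Lemma one_point_eq f (f1 : one_point f) (x y : supp f) : x = y.
Proof. by case: f1 => p pU; rewrite (pU x) (pU y). Qed.

Lemma comp_point f g h (G : matrix_hom g h) (F : matrix_hom f g) x y
    (z : supp g) :
  one_point g -> matrix_comp G F x y = G z y \oc F x z.
Proof. by move=> g1; apply: comp_row1 => z'; have := one_point_eq g1 z' z. Qed.

Lemma eqm_loop (a : C) (e : a = a) : eqm e = idm a.
Proof. exact: (eqmE e erefl). Qed.

(** Two indices in a one-point support are equal, but not convertible, so the
    identification of the values at them needs a cast. Writing the cast as a
    morphism of [C], rather than rewriting indices inside the types of entries,
    reduces the comparison of entries at different names of the same point to
    [transport_comp] and [transport_nat]. *)
Definition transport f (f1 : one_point f) (x y : supp f) : hom (f x) (f y) :=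
  eqm (congr1 f (one_point_eq f1 x y)).

Lemma transport_loop f (f1 : one_point f) x : transport f1 x x = idm (f x).
Proof. exact: eqm_loop. Qed.

Lemma transport_comp f (f1 : one_point f) x y z :
  transport f1 y z \oc transport f1 x y = transport f1 x z.
Proof. by rewrite /transport eqm_comp; exact: eqmE. Qed.

Lemma transport_nat f g (f1 : one_point f) (g1 : one_point g)
    (F : matrix_hom f g) x x' y y' :
  F x' y' \oc transport f1 x x' = transport g1 y y' \oc F x y.
Proof.
have ? := one_point_eq f1 x x'; have ? := one_point_eq g1 y y'; subst.
by rewrite !transport_loop comp1m compm1.
Qed.

Lemma matrix_id_transport f (f1 : one_point f) x y :
  matrix_id f x y = transport f1 x y.
Proof.
by case: _ / (one_point_eq f1 x y); rewrite matrix_idxx transport_loop.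
Qed.

End OnePoint.

(** * The functor placing an object at the distinguished point *)

Section PointFunctor.
Context (C : monAbCategory) (strictC : is_strict C) (S0 : choiceType).
Context (gamma : S0 * S0 -> S0) (gammaB : bijective gamma) (star : S0).

Local Notation M := (matrix_monCategory strictC gammaB star).

Lemma one_point_unit : one_point (munit M).
Proof. by exists (pstar C star) => x; exact: punit_uniq. Qed.

Lemma one_point_tens (f g : M) : one_point f -> one_point g -> one_point (f \ox g).
Proof.
move=> f1 g1; have [p _] := f1; have [q _] := g1.
by exists (spair gamma p q) => s; apply: sunpair_inj; exact: one_point_eq.
Qed.

Local Notation D := (full_monoidal_subcategory one_point_unit one_point_tens).

Lemma comp_entry (f g h : D) (G : hom g h) (F : hom f g)
    (x : supp (sval f)) (y : supp (sval h)) (z : supp (sval g)) :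
  entry (G \oc F) x y = entry G z y \oc entry F x z.
Proof. exact: comp_point (svalP g). Qed.

Definition point_family (a : C) : pfamily C S0 := PFamily (fun _ : [set star] => a).

Lemma one_point_family a : one_point (point_family a).
Proof. exact: one_point_unit. Qed.

Definition point_obj (a : C) : D := exist _ (point_family a) (one_point_family a).

Definition the_point (a : C) : supp (sval (point_obj a)) := pstar C star.

Definition point_map (a b : C) (u : hom a b) : hom (point_obj a) (point_obj b) :=
  @point_matrix C S0 (point_family a) (point_family b) (one_point_family b)
    (fun _ _ => u).

Lemma point_idE a x y : matrix_id (point_family a) x y = idm a.
Proof. by rewrite (matrix_id_transport (one_point_family a)); exact: eqm_loop. Qed.

Lemma point_map1 a : point_map (idm a) = idm (point_obj a).
Proof. by apply: matrix_homP => x y; rewrite [RHS]point_idE. Qed.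

Lemma point_mapM a b c (v : hom b c) (u : hom a b) :
  point_map (v \oc u) = point_map v \oc point_map u.
Proof.
by apply: matrix_homP => x y; rewrite [RHS](comp_entry _ _ _ _ (the_point _)).
Qed.

Definition point_functor : functor C D := Functor point_map1 point_mapM.

(** * The monoidal constraints of the functor *)

Definition point_phi2 (a b : C) :
    hom (point_obj a \ox point_obj b) (point_obj (a \ox b)) :=
  @point_matrix C S0 (ptens gamma (point_family a) (point_family b))
    (point_family (a \ox b)) (one_point_family _) (fun _ _ => idm (a \ox b)).

Lemma point_phi2_iso a b : is_iso (point_phi2 a b).
Proof.
have ab1 := one_point_tens (one_point_family a) (one_point_family b).
pose psi : hom (point_obj (a \ox b)) (point_obj a \ox point_obj b) :=
  @point_matrix C S0 (point_family (a \ox b))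
    (ptens gamma (point_family a) (point_family b)) ab1
    (fun _ _ => idm (a \ox b)).
have [s _] := svalP (point_obj a \ox point_obj b).
exists psi; split; apply: matrix_homP => x y.
  rewrite (comp_entry _ _ _ _ (the_point _)).
  apply: etrans (comp1m (idm (a \ox b))) _; apply: esym.
  by apply: etrans (matrix_id_transport ab1 x y) _; exact: eqm_loop.
rewrite (comp_entry _ _ _ _ s).
by apply: etrans (comp1m (idm (a \ox b))) _; rewrite [RHS]point_idE.
Qed.

Lemma point_phi2_nat (a a' b b' : C) (u : hom a a') (v : hom b b') :
  point_map (u \om v) \oc point_phi2 a b =
  point_phi2 a' b' \oc (point_map u \om point_map v).
Proof.
have [s _] := svalP (point_obj a' \ox point_obj b').
apply: matrix_homP => x y.
rewrite (comp_entry _ _ _ _ (the_point _)) (comp_entry _ _ _ _ s).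
exact: etrans (compm1 (u \om v)) (esym (comp1m (u \om v))).
Qed.

(** By strictness the constraint of [C] is itself the identity between two equal
    objects, and the Kronecker symbol is that identity too because all the indices
    that it compares are [star]. *)
Lemma assoc_point_entry a b c x y :
  entry (assoc (point_obj a) (point_obj b) (point_obj c)) x y = assoc a b c.
Proof.
rewrite (strict_assoc strictC).
have R : assoc_rel x y by split; exact: punit_uniq.
by apply: etrans (deltaT _ R) _; exact: eqmE.
Qed.

Lemma runit_point_entry a x y :
  entry (runit (point_obj a)) x y = runit a.
Proof.
rewrite (strict_runit strictC).
have R : sfst x = y by exact: punit_uniq.
by apply: etrans (deltaT _ R) _; exact: eqmE.
Qed.

Lemma lunit_point_entry a x y :
  entry (lunit (point_obj a)) x y = lunit a.
Proof.
rewrite (strict_lunit strictC).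
have R : ssnd x = y by exact: punit_uniq.
by apply: etrans (deltaT _ R) _; exact: eqmE.
Qed.

Lemma point_phi2_assoc (a b c : C) :
  point_phi2 a (b \ox c) \oc (idm (point_obj a) \om point_phi2 b c)
    \oc assoc (point_obj a) (point_obj b) (point_obj c) =
  point_map (assoc a b c) \oc point_phi2 (a \ox b) c
    \oc (point_phi2 a b \om idm (point_obj c)).
Proof.
have [s _] := svalP (point_obj (a \ox b) \ox point_obj c).
have [t _] := svalP (point_obj a \ox point_obj (b \ox c)).
have [w _] := svalP (point_obj a \ox (point_obj b \ox point_obj c)).
apply: matrix_homP => x y.
rewrite (comp_entry _ _ _ _ w) (comp_entry _ _ _ _ t) assoc_point_entry.
rewrite (comp_entry _ _ _ _ s) (comp_entry _ _ _ _ (the_point _)).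
(* An entry of a tensor product of matrices is a tensor product of entries, here
   of identities, so that both whiskered constraints have identity entries. *)
have -> : entry (idm (point_obj a) \om point_phi2 b c) w t = idm (a \ox (b \ox c)).
  by apply: etrans (tensm1 a (b \ox c)); congr tensm; exact: point_idE.
have -> : entry (point_phi2 a b \om idm (point_obj c)) x s = idm ((a \ox b) \ox c).
  by apply: etrans (tensm1 (a \ox b) c); congr tensm; exact: point_idE.
by rewrite !comp1m !compm1.
Qed.

(** An identity suffices here because the unit object of the category of matrices
    is the unit of [C] placed at [star], definitionally. *)
Definition point_phi0 : hom (munit D) (point_obj (munit C)) :=
  idm (point_obj (munit C)).

Lemma point_phi0_iso : is_iso point_phi0.
Proof. by exists point_phi0; split; exact: comp1m. Qed.

Lemma point_phi2_lunit (a : C) :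
  lunit (point_obj a) =
  point_map (lunit a) \oc point_phi2 (munit C) a
    \oc (point_phi0 \om idm (point_obj a)).
Proof.
have [s _] := svalP (point_obj (munit C) \ox point_obj a).
apply: matrix_homP => x y; rewrite lunit_point_entry.
rewrite (comp_entry _ _ _ _ s) (comp_entry _ _ _ _ (the_point _)).
have -> : entry (point_phi0 \om idm (point_obj a)) x s = idm (munit C \ox a).
  by apply: etrans (tensm1 (munit C) a); congr tensm; exact: point_idE.
by rewrite !compm1.
Qed.

Lemma point_phi2_runit (a : C) :
  runit (point_obj a) =
  point_map (runit a) \oc point_phi2 a (munit C)
    \oc (idm (point_obj a) \om point_phi0).
Proof.
have [s _] := svalP (point_obj a \ox point_obj (munit C)).
apply: matrix_homP => x y; rewrite runit_point_entry.
rewrite (comp_entry _ _ _ _ s) (comp_entry _ _ _ _ (the_point _)).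
have -> : entry (idm (point_obj a) \om point_phi0) x s = idm (a \ox munit C).
  by apply: etrans (tensm1 a (munit C)); congr tensm; exact: point_idE.
by rewrite !compm1.
Qed.

Definition point_tensor_functor : tensor_functor C D :=
  @TensorFunctor C D point_functor point_phi0 point_phi2
    point_phi0_iso point_phi2_iso point_phi2_nat
    point_phi2_assoc point_phi2_lunit point_phi2_runit.

(** * Evaluation as a quasi-inverse *)

Definition only_point (f : D) : supp (sval f) := projT1 (cid (svalP f)).

Definition eval_obj (f : D) : C := sval f (only_point f).

Definition eval_map (f g : D) (F : hom f g) : hom (eval_obj f) (eval_obj g) :=
  entry F (only_point f) (only_point g).

Lemma eval_map1 f : eval_map (idm f) = idm (eval_obj f).
Proof. exact: matrix_idxx. Qed.

Lemma eval_mapM f g h (G : hom g h) (F : hom f g) :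
  eval_map (G \oc F) = eval_map G \oc eval_map F.
Proof. exact: comp_entry. Qed.

Definition eval_functor : functor D C := Functor eval_map1 eval_mapM.

(** Evaluating [f] and placing the value at [star] forgets where [f] was
    supported; [unplace f] brings the value back there, naturally in [f], and
    [place f] is its inverse. *)
Definition unplace (f : D) : hom (point_obj (eval_obj f)) f :=
  @point_matrix C S0 (point_family (eval_obj f)) (sval f) (svalP f)
    (fun _ y => transport (svalP f) (only_point f) y).

Definition place (f : D) : hom f (point_obj (eval_obj f)) :=
  @point_matrix C S0 (sval f) (point_family (eval_obj f)) (one_point_family _)
    (fun x _ => transport (svalP f) x (only_point f)).

Lemma unplace_iso f : is_iso (unplace f).
Proof.
exists (place f); split; apply: matrix_homP => x y.
  rewrite (comp_entry _ _ _ _ (only_point f)) [RHS]point_idE.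
  set p := only_point f.
  exact: etrans (transport_comp (svalP f) p p p) (transport_loop (svalP f) p).
rewrite (comp_entry _ _ _ _ (the_point _)).
rewrite [RHS](matrix_id_transport (svalP f)).
exact: (transport_comp (svalP f) x (only_point f) y).
Qed.

Lemma unplace_nat f g (F : hom f g) :
  F \oc unplace f = unplace g \oc point_map (eval_map F).
Proof.
apply: matrix_homP => x y.
rewrite (comp_entry _ _ _ _ (only_point f)) (comp_entry _ _ _ _ (the_point _)).
exact: (transport_nat (svalP f) (svalP g) F).
Qed.

Lemma point_functor_equivalence : is_equivalence point_functor.
Proof.
exists eval_functor; split.
  exists (fun a => idm a); split=> [a|a b u].
    by exists (idm a); split; exact: comp1m.
  exact: etrans (compm1 u) (esym (comp1m u)).
by exists unplace; split; [exact: unplace_iso|exact: unplace_nat].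
Qed.

End PointFunctor.

Theorem proposition1p8 (C : monAbCategory) (strictC : is_strict C)
    (S0 : choiceType) (infS0 : infinite_set [set: S0])
    (gamma : S0 * S0 -> S0) (gammaB : bijective gamma) (star : S0) :
  exists (D : set (matrix_monCategory strictC gammaB star))
         (D1 : D (munit (matrix_monCategory strictC gammaB star)))
         (DM : forall f g : matrix_monCategory strictC gammaB star,
                 D f -> D g -> D (f \ox g))
         (T : tensor_functor C (full_monoidal_subcategory D1 DM)),
    is_equivalence T.
Proof.
exists (@one_point C S0), (one_point_unit strictC gammaB star).
exists (@one_point_tens C strictC S0 gamma gammaB star).
exists (point_tensor_functor strictC gammaB star).
exact: point_functor_equivalence.
Qed.
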